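(* Continuously topo-bisimilar states satisfy the same modal formulae: if $M,w \rightleftharpoons M',w'$ then for every formula $\varphi$, $M,w\models\varphi$ iff $M',w'\models\varphi$.
   Context: Formulas are built from propositional variables using $\wedge$, a negation, and $\Box$ (dual $\Diamond$). A paraconsistent topological model $\langle S,\sigma,V\rangle$ has $\sigma$ a closed set topology, $V(p)$ closed, and $[p]=V(p)$, $[\varphi\wedge\psi]=[\varphi]\cap[\psi]$, $[\sim\varphi]=\mathsf{Clo}(S\setminus[\varphi])$, $[\Box\varphi]=\mathsf{Int}([\varphi])$, $[\Diamond\varphi]=\mathsf{Clo}([\varphi])$; a paracomplete topological model has an open set topology, $V(p)$ open, and negation $\dot{\sim}$ with $[\dot{\sim}\varphi]=\mathsf{Int}(S\setminus[\varphi])$. Topo-bisimulation between topological models $\langle S,\sigma,V\rangle$ and $\langle S',\sigma',V'\rangle$: a relation $Z\subseteq S\times S'$ such that whenever $sZs'$: (1) $s,s'$ satisfy the same propositional variables; (2) for every open $O\ni s$ there is an open $O'\ni s'$ such that every $t'\in O'$ has some $t\in O$ with $tZt'$; (3) for every open $O'\ni s'$ there is an open $O\ni s$ such that every $t\in O$ has some $t'\in O'$ with $tZt'$. For two paraconsistent (respectively paracomplete) topological models $M=\langle S,\sigma,V\rangle$, $M'=\langle S',\sigma',V'\rangle$, $M,w$ and $M',w'$ are continuously topo-bisimilar ($M,w\rightleftharpoons M',w'$) if they are topo-bisimilar and there is a homeomorphism $f$ between $\langle S,\sigma\rangle$ and $\langle S',\sigma'\rangle$ with $V'(p)=f(V(p))$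 for all $p$. *)

(* Defs.v *)
From mathcomp Require Import all_boot all_classical topology_theory.topology.

Local Open Scope classical_set_scope.

(* [Neg] is one syntactic symbol; it is read as the paraconsistent negation by
   [pcons_ext] and as the paracomplete one by [pcomp_ext].  [Dia] is primitive:
   Clo [phi] is not in general the extension of [Neg (Box (Neg phi))] under
   either reading of [Neg]. *)
Inductive formula (P : Type) : Type :=
| Var of P
| And of formula P & formula P
| Neg of formula P
| Box of formula P
| Dia of formula P.
Arguments Var {P} _.
Arguments And {P} _ _.
Arguments Neg {P} _.
Arguments Box {P} _.
Arguments Dia {P} _.

Record topo_model (P : Type) : Type := TopoModel {
  carrier :> topologicalType;
  valuation : P -> set carrier
}.
Arguments carrier {P} _.
Arguments valuation {P} _ _ _.

(* A topology given by its family of closed sets and one given by its family of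
   open sets are the same [topologicalType]; the two kinds of models differ in
   which of the two families the valuation takes its values in. *)
Definition paraconsistent {P : Type} (M : topo_model P) : Prop :=
  forall p, closed (valuation M p).

Definition paracomplete {P : Type} (M : topo_model P) : Prop :=
  forall p, open (valuation M p).

Fixpoint pcons_ext {P : Type} (M : topo_model P) (phi : formula P) : set M :=
  match phi with
  | Var p => valuation M p
  | And a b => pcons_ext M a `&` pcons_ext M b
  | Neg a => closure (~` pcons_ext M a)
  | Box a => interior (pcons_ext M a)
  | Dia a => closure (pcons_ext M a)
  end.

Fixpoint pcomp_ext {P : Type} (M : topo_model P) (phi : formula P) : set M :=
  match phi with
  | Var p => valuation M p
  | And a b => pcomp_ext M a `&` pcomp_ext M b
  | Neg a => interior (~` pcomp_ext M a)
  | Box a => interior (pcomp_ext M a)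
  | Dia a => closure (pcomp_ext M a)
  end.

Definition pcons_sat {P : Type} {M : topo_model P} (w : M) (phi : formula P) :
  Prop := pcons_ext M phi w.

Definition pcomp_sat {P : Type} {M : topo_model P} (w : M) (phi : formula P) :
  Prop := pcomp_ext M phi w.

Definition topo_bisimulation {P : Type} {M M' : topo_model P}
    (Z : M -> M' -> Prop) : Prop :=
  forall s s', Z s s' ->
  [/\ forall p, valuation M p s <-> valuation M' p s',
      forall O : set M, open O -> O s ->
        exists O' : set M', [/\ open O', O' s' &
          forall t', O' t' -> exists t, O t /\ Z t t'] &
      forall O' : set M', open O' -> O' s' ->
        exists O : set M, [/\ open O, O s &
          forall t, O t -> exists t', O' t' /\ Z t t'] ].

Definition topo_bisimilar {P : Type} {M M' : topo_model P} (w : M) (w' : M') :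
  Prop := exists Z : M -> M' -> Prop, topo_bisimulation Z /\ Z w w'.

Definition homeomorphism {S S' : topologicalType} (f : S -> S') : Prop :=
  exists g : S' -> S, [/\ cancel f g, cancel g f, continuous f & continuous g].

(* The homeomorphism is not required to send [w] to [w'], nor to be related to
   the bisimulation. *)
Definition cont_topo_bisimilar {P : Type} {M M' : topo_model P}
    (w : M) (w' : M') : Prop :=
  topo_bisimilar w w' /\
  exists f : M -> M', homeomorphism f /\ forall p, valuation M' p = f @` valuation M p.

(* Main.v *)
(* Bisimilarity alone suffices: if sets [A] and [A'] agree along a
   topo-bisimulation, then so do their interiors, and hence, taking
   complements, their closures. Both kinds of extension are built from such
   operators, so induction on the formula concludes. *)
Require Import Defs.
From mathcomp Require Import all_boot all_classical topology_theory.topology.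

Local Open Scope classical_set_scope.

(** Invariance along [Z] is phrased for arbitrary sets, not for extensions of formulas, so that both
    semantics share the same preservation lemmas. *)
Definition agree_along {S S' : Type} (Z : S -> S' -> Prop)
    (A : set S) (A' : set S') : Prop :=
  forall s s', Z s s' -> (A s <-> A' s').

Section Agreement.
Context {S S' : Type} (Z : S -> S' -> Prop).

Lemma agree_alongC (A : set S) (A' : set S') :
  agree_along Z A A' -> agree_along Z (~` A) (~` A').
Proof. by move=> AA' s s' /AA' [h h']; split=> nA; [move/h'|move/h]. Qed.

Lemma agree_alongI (A B : set S) (A' B' : set S') :
  agree_along Z A A' -> agree_along Z B B' ->
  agree_along Z (A `&` B) (A' `&` B').
Proof.
move=> AA' BB' s s' Zss'; have [? ?] := AA' s s' Zss'.
by have [? ?] := BB' s s' Zss'; split=> -[? ?]; split; auto.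
Qed.

End Agreement.

Section Invariance.
Context {P : Type} {M M' : topo_model P} {Z : M -> M' -> Prop}.
Context (Zbis : topo_bisimulation Z).

(** The interior of [A] is itself an open set around [s], so the forth clause can be applied to it.
    Each point of the resulting open [O'] around [s'] is related to a point of [A], hence lies in
    [A']; thus [O'] witnesses that [s'] is interior to [A']. The back clause gives the converse in
    the same way. *)
Lemma agree_along_interior (A : set M) (A' : set M') :
  agree_along Z A A' -> agree_along Z (interior A) (interior A').
Proof.
move=> AA' s s' /Zbis [_ forth back]; split=> As.
- have [O' [oO' O's' O'Z]] := forth _ (open_interior A) As.
  rewrite /interior nbhsE; exists O' => // t' /O'Z [t [At Ztt']].
  by apply/(AA' _ _ Ztt'); exact: interior_subset.
- have [O [oO Os OZ]] := back _ (open_interior A') As.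
  rewrite /interior nbhsE; exists O => // t /OZ [t' [At' Ztt']].
  by apply/(AA' _ _ Ztt'); exact: interior_subset.
Qed.

Lemma agree_along_closure (A : set M) (A' : set M') :
  agree_along Z A A' -> agree_along Z (closure A) (closure A').
Proof.
(* The double complement exposes the complement of each closure, which [interiorC], read backwards,
   turns into the interior of a complement. *)
move=> AA'; rewrite -(setCK (closure A)) -(setCK (closure A')) -!interiorC.
by apply/agree_alongC/agree_along_interior/agree_alongC.
Qed.

Lemma agree_along_valuation (p : P) :
  agree_along Z (valuation M p) (valuation M' p).
Proof. by move=> s s' /Zbis []. Qed.

Lemma agree_along_pcons_ext (phi : formula P) :
  agree_along Z (pcons_ext M phi) (pcons_ext M' phi).
Proof.
elim: phi => [p|a IHa b IHb|a IH|a IH|a IH] /=.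
- exact: agree_along_valuation.
- exact: agree_alongI.
- exact/agree_along_closure/agree_alongC.
- exact: agree_along_interior.
- exact: agree_along_closure.
Qed.

Lemma agree_along_pcomp_ext (phi : formula P) :
  agree_along Z (pcomp_ext M phi) (pcomp_ext M' phi).
Proof.
elim: phi => [p|a IHa b IHb|a IH|a IH|a IH] /=.
- exact: agree_along_valuation.
- exact: agree_alongI.
(* Negation is the one case that differs from the paraconsistent induction: an interior replaces the
   closure. *)
- exact/agree_along_interior/agree_alongC.
- exact: agree_along_interior.
- exact: agree_along_closure.
Qed.

End Invariance.

Theorem theorem3p16 (P : Type) :
  (forall (M M' : topo_model P) (w : M) (w' : M'),
     paraconsistent M -> paraconsistent M' ->
     cont_topo_bisimilar w w' ->
     forall phi : formula P, pcons_sat w phi <-> pcons_sat w' phi)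
  /\
  (forall (M M' : topo_model P) (w : M) (w' : M'),
     paracomplete M -> paracomplete M' ->
     cont_topo_bisimilar w w' ->
     forall phi : formula P, pcomp_sat w phi <-> pcomp_sat w' phi).
Proof.
split=> M M' w w' _ _ [[Z [Zbis Zww']] _] phi.
- exact: (agree_along_pcons_ext Zbis phi w w' Zww').
- exact: (agree_along_pcomp_ext Zbis phi w w' Zww').
Qed.
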